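(* Let $G$ be a graph with maximum degree $\Delta$ and boxicity $b\ge 3$. Then $G$ contains an induced (chordless) cycle of length at least $\lfloor \log_{\Delta}(b-2)\rfloor+2$.
   Context: The boxicity of $G$ is the minimum $b$ such that $G$ is the intersection graph of axis-parallel boxes in $\mathbb{R}^b$ (products of $b$ closed intervals), one box per vertex. An induced cycle is a cycle in $G$ with no chord (no edge of $G$ joining two non-consecutive vertices of the cycle). *)

(* Defs.v *)
From Stdlib Require Import Reals.
From mathcomp Require Import all_boot.
Set Implicit Arguments. Unset Strict Implicit. Unset Printing Implicit Defensive.

(* A (finite, simple) graph: vertex type T : finType, adjacency e : rel T,
   assumed symmetric and irreflexive in the theorem. *)

Definition in_box (b : nat) (l u : 'I_b -> R) (p : 'I_b -> R) : Prop :=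
  forall i : 'I_b, Rle (l i) (p i) /\ Rle (p i) (u i).

Definition box_representable (T : finType) (e : rel T) (b : nat) : Prop :=
  exists (l u : T -> 'I_b -> R),
    (forall v i, Rle (l v i) (u v i)) /\
    (forall x y : T, x != y ->
       (e x y <-> exists p : 'I_b -> R, in_box (l x) (u x) p /\ in_box (l y) (u y) p)).

Definition boxicity (T : finType) (e : rel T) (b : nat) : Prop :=
  box_representable e b /\ forall b', (b' < b)%N -> ~ box_representable e b'.

Definition max_degree (T : finType) (e : rel T) : nat :=
  \max_(v : T) #|[set w | e v w]|.

Definition induced_cycle (T : finType) (e : rel T) (k : nat) (f : 'I_k -> T) : Prop :=
  (3 <= k)%N /\ injective f /\
  forall i j : 'I_k,
    e (f i) (f j) = ((val j == (val i).+1 %% k) || (val i == (val j).+1 %% k)).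

(* Main.v *)
Require Import Defs.
From Stdlib Require Import Reals Classical Lra.
From mathcomp Require Import all_boot.
From mathcomp Require Import zify.
Set Implicit Arguments. Unset Strict Implicit. Unset Printing Implicit Defensive.

(* Write D for the maximum degree and t for the floor of log_D (b - 2), so that
   D^t <= b - 2 when D >= 2.
   For t >= 3 no such graph exists: a colouring of the square of the graph with
   D^2 + 1 colours yields a representation in dimension 2 D^2 + 1 <= D^3 + 1 < b.
   For t = 2, a graph without induced cycle of length at least 4 is chordal.
   Maximum cardinality search gives a perfect elimination ordering, hence a
   rooted forest in which adjacent vertices are comparable.  One interval
   graph separates incomparable vertices and one per colour of a proper
   (D + 1)-colouring separates the others: the dimension is at most
   D + 2 <= D^2 + 1 < b.
   For t <= 1, a graph without cycles has a representation in the plane, where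
   the second coordinate is the depth in that forest. *)

(** * Boxes with integer corners, and greedy colouring *)

Lemma box_representable_nat (T I : finType) (e : rel T) (l u : I -> T -> nat) :
    symmetric e ->
    (forall i x, l i x <= u i x) ->
    (forall i x y, e x y -> l i x <= u i y) ->
    (forall x y, x != y -> ~~ e x y ->
       exists i, (u i y < l i x) || (u i x < l i y)) ->
  box_representable e #|I|.
Proof.
move=> esym lu adj sep.
exists (fun x i => INR (l (enum_val i) x)), (fun x i => INR (u (enum_val i) x)).
split=> [v i|x y neq_xy]; first by apply: le_INR; apply/leP; exact: lu.
split=> [exy|[p [px py]]].
(* In each coordinate the larger left end is a common point of both intervals. *)
- exists (fun i => INR (maxn (l (enum_val i) x) (l (enum_val i) y))).
  have eyx : e y x by rewrite esym.
  split=> i; split; apply: le_INR; apply/leP;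
    rewrite ?leq_maxl ?leq_maxr ?geq_max ?lu ?andbT ?adj //.
- apply/negPn/negP => /(sep _ _ neq_xy)[i].
  have := px (enum_rank i); have := py (enum_rank i); rewrite /= enum_rankK.
  by move=> [ly uy] [lx ux] /orP[] /ltP/lt_INR; lra.
Qed.

(** At most [D] of the [D.+1] colours occur on the neighbours of a vertex, so one is always free. In
    the induction the colouring is total but proper only on [s]. *)
Lemma greedy_colouring (T : finType) (r : rel T) (D : nat) :
    symmetric r -> irreflexive r -> (forall x, #|[set y | r x y]| <= D) ->
  exists c : T -> 'I_D.+1, forall x y, r x y -> c x != c y.
Proof.
move=> rsym rirr degD.
suff H : forall s : seq T, exists c : T -> 'I_D.+1,
    {in s &, forall x y, r x y -> c x != c y}.
  have [c Hc] := H (enum T).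
  by exists c => x y; apply: Hc; rewrite mem_enum.
elim=> [|v s [c Hc]]; first by exists (fun=> ord0).
have [k Hk] : exists k : 'I_D.+1, k \notin [set c y | y in [set y | r v y]].
  apply/existsP; rewrite -negb_forall; apply/negP => /forallP all_used.
  have := leq_trans (leq_imset_card c _) (degD v).
  rewrite (_ : [set c y | y in _] = setT) ?cardsT ?card_ord ?ltnn //.
  by apply/setP=> k; rewrite in_setT all_used.
have free y : r v y -> k != c y.
  by move=> rvy; apply: contraNneq Hk => ->; apply: imset_f; rewrite inE.
exists (fun x => if x == v then k else c x) => x y.
rewrite !inE; have [->|nxv] := eqVneq x v; have [->|nyv] := eqVneq y v => //= xs ys.
- by rewrite rirr.
- exact: free.
- by rewrite rsym eq_sym; exact: free.
- exact: Hc.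
Qed.

(* Vertices outside the class [k] all share the point 0; the vertex [x] of the
   class sits at [(rho x).+1], and [y] reaches up to its highest neighbour in
   the class. *)
Section ColourIntervals.
Variables (T K : finType) (e : rel T) (c : T -> K) (rho : T -> nat).

Definition colour_lo (k : K) (x : T) : nat :=
  if c x == k then (rho x).+1 else 0.

Definition colour_hi (k : K) (x : T) : nat :=
  if c x == k then (rho x).+1 else \max_(z | e x z && (c z == k)) (rho z).+1.

Lemma colour_lo_hi k x : colour_lo k x <= colour_hi k x.
Proof. by rewrite /colour_lo /colour_hi; case: ifP. Qed.

Lemma colour_adj k x y : symmetric e -> (forall x y, e x y -> c x != c y) ->
  e x y -> colour_lo k x <= colour_hi k y.
Proof.
move=> esym c_proper exy; rewrite /colour_lo /colour_hi.
case: eqP => // cx; case: eqP => cy.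
  by have := c_proper _ _ exy; rewrite cx cy eqxx.
apply: (@leq_bigmax_cond _ _ (fun z => (rho z).+1)).
by rewrite esym exy cx eqxx.
Qed.

(** In one class, [x] and [y] are distinct points. Otherwise the interval of [y] starts at 0 and
    ends below [x], as do all neighbours of [y] in the class of [x]. *)
Lemma colour_sep x y : rho x <> rho y ->
    (c x <> c y -> forall z, e y z -> c z = c x -> rho z < rho x) ->
  (colour_hi (c x) y < colour_lo (c x) x)
  || (colour_hi (c x) x < colour_lo (c x) y).
Proof.
move=> nrho sep; rewrite /colour_lo /colour_hi eqxx.
case: eqP => [_|/nesym ncxy]; first by rewrite !ltnS -neq_ltn; apply/eqP/nesym.
apply/orP; left; rewrite ltnS; apply/bigmax_leqP => z /andP[eyz /eqP czx].
exact: sep.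
Qed.
End ColourIntervals.

(** * Representation from a colouring of the square *)

Section Degree.
Variables (T : finType) (e : rel T).
Hypotheses (esym : symmetric e) (eirr : irreflexive e).

Lemma leq_max_degree x : #|[set y | e x y]| <= max_degree e.
Proof. exact: (@leq_bigmax _ (fun v => #|[set w | e v w]|)). Qed.

Definition square_rel : rel T :=
  fun x y => (x != y) && (e x y || [exists z, e x z && e z y]).

(** Each neighbour [z] of [x] contributes itself and its neighbours other than [x], at most the
    degree of [z] in all, because [x] is a neighbour of [z]. *)
Lemma square_degree x : #|[set y | square_rel x y]| <= max_degree e ^ 2.
Proof.
have sub : [set y | square_rel x y]
    \subset \bigcup_(z in [set z | e x z]) (z |: ([set y | e z y] :\ x)).
  apply/subsetP => y; rewrite inE => /andP[nxy /orP[exy|/existsP[z /andP[exz ezy]]]];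
    apply/bigcupP; [exists y | exists z]; rewrite ?inE //.
    by rewrite eqxx.
  by rewrite ezy (eq_sym y x) nxy orbT.
apply: (leq_trans (subset_leq_card sub)).
apply: (@leq_trans (\sum_(z in [set z | e x z]) max_degree e)); last first.
  by rewrite sum_nat_const -mulnn leq_mul2r leq_max_degree orbT.
have union_bound (F : T -> {set T}) (P : pred T) :
    #|\bigcup_(z | P z) F z| <= \sum_(z | P z) #|F z|.
  elim/big_rec2: _ => [|z m A _ le_Am]; first by rewrite cards0.
  by rewrite (leq_trans (leq_card_setU _ _)) ?leq_add2l.
apply: (leq_trans (union_bound _ _)); apply: leq_sum => z; rewrite inE => exz.
apply: leq_trans (leq_max_degree z).
have xz : x \in [set y | e z y] by rewrite inE esym.
by rewrite cardsU1 [in leqRHS](cardsD1 x) xz leq_add2r leq_b1.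
Qed.

(** In a proper colouring of the square, [y] has at most one neighbour in the class of a
    non-adjacent [x]. If present, it precedes [x] either in the enumeration [rho] or in its reverse
    [rho'], and that order separates [x] from [y]. *)
Lemma box_representable_square :
  box_representable e (2 * max_degree e ^ 2).+1.
Proof.
have sq_sym : symmetric square_rel.
  move=> x y; rewrite /square_rel eq_sym esym; congr (_ && (_ || _)).
  by apply: eq_existsb => z; rewrite andbC !(esym z).
have sq_irr : irreflexive square_rel by move=> x; rewrite /square_rel eqxx.
have [c c_sq] := greedy_colouring sq_sym sq_irr square_degree.
have c_proper x y : e x y -> c x != c y.
  move=> exy; apply: c_sq; rewrite /square_rel exy andbT.
  by apply: contraTneq exy => ->; rewrite eirr.
pose rho (x : T) : nat := enum_rank x.
pose rho' x := #|T| - rho x.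
have rho_inj x y : x != y -> rho x <> rho y.
  by move=> /eqP nxy /val_inj/enum_rank_inj.
have rho_lt x : rho x < #|T| by exact: ltn_ord.
have -> : (2 * max_degree e ^ 2).+1
    = #|{: 'I_(max_degree e ^ 2).+1 + 'I_(max_degree e ^ 2)}|.
  by rewrite card_sum !card_ord; lia.
(* A pair from two classes may be separated in either one, so one class needs
   no reversed copy. *)
apply: (@box_representable_nat _ _ e
  (fun i => match i with
     inl k => colour_lo c rho k | inr k => colour_lo c rho' (lift ord0 k) end)
  (fun i => match i with
     inl k => colour_hi e c rho k | inr k => colour_hi e c rho' (lift ord0 k) end)) => //.
- by case=> k x; exact: colour_lo_hi.
- by case=> k x y; exact: colour_adj.
move=> x y nxy nexy.
have [cxy|] := eqVneq (c x) (c y).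
  by exists (inl (c x)); apply: colour_sep; [exact: rho_inj|rewrite cxy].
(* The two colours differ, so at least one of them is not [ord0]; a swap makes it that of [x]. *)
wlog nx0 : x y nxy nexy / c x != ord0.
  move=> gen ncxy; have [cx0|nx0] := eqVneq (c x) ord0; last exact: (gen x y).
  have [||||i] := gen y x; rewrite ?(eq_sym y) 1?(eq_sym (c y)) 1?esym //.
    by rewrite -cx0.
  by exists i; rewrite orbC.
move=> ncxy.
have [k0 ck0] : exists k0, c x = lift ord0 k0.
  by case: (unliftP ord0 (c x)) nx0 => [k0 ->|->]; [exists k0|rewrite eqxx].
have uniq_nbr z z' : e y z -> e y z' -> c z = c z' -> z = z'.
  move=> eyz eyz' czz'; apply/eqP; apply/negPn/negP => nzz'.
  suff /c_sq : square_rel z z' by rewrite czz' eqxx.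
  by rewrite /square_rel nzz' /=; apply/orP; right; apply/existsP; exists y; rewrite esym eyz.
have [/existsP[a /and3P[eya /eqP ca lt_xa]]|/existsPn none] :=
    boolP [exists a, [&& e y a, c a == c x & rho x < rho a]].
  exists (inr k0) => /=; rewrite -ck0; apply: colour_sep.
    by have := rho_inj _ _ nxy; move: (rho_lt x) (rho_lt y); rewrite /rho'; lia.
  move=> _ z eyz cz; rewrite (uniq_nbr z a) ?cz //.
  by move: (rho_lt a) lt_xa; rewrite /rho'; lia.
exists (inl (c x)) => /=; apply: colour_sep; first exact: rho_inj.
move=> _ z eyz /eqP cz; move: (none z); rewrite eyz cz /= -leqNgt leq_eqVlt.
case/orP=> // /eqP/val_inj/enum_rank_inj zx.
by rewrite -zx esym eyz in nexy.
Qed.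
End Degree.

(** * Chordal graphs and perfect elimination orderings *)

Section Chordal.
Variables (T : finType) (e : rel T).
Hypotheses (esym : symmetric e) (eirr : irreflexive e).

Definition induced_path (w : seq T) : Prop :=
  uniq w /\ forall x0 i j, i < size w -> j < size w ->
    e (nth x0 w i) (nth x0 w j) = (j == i.+1) || (i == j.+1).

(** [k] is put at index 0, before the path, so the successor modulo the length wraps around only
    from the far end of [w] back to [k]. *)
Lemma induced_cycle_of_path k w :
    induced_path w -> k \notin w -> 2 <= size w ->
    (forall i, i < size w ->
       e k (nth k w i) = (i == 0) || (i == (size w).-1)) ->
  exists f : 'I_(size w).+1 -> T, induced_cycle e f.
Proof.
move=> [uw indw] kw sw ek; exists (fun i => nth k (k :: w) i).
split; [by []|split] => [i j /eqP|[i lti] [j ltj]].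
  by rewrite nth_uniq //= ?kw // => /eqP/val_inj.
have modS m : m < (size w).+1 ->
    m.+1 %% (size w).+1 = if m == size w then 0 else m.+1.
  move=> ltm; have [->|neq] := eqVneq m (size w); first by rewrite modnn.
  by rewrite modn_small //; lia.
rewrite /= !modS //; case: i j lti ltj => [|i] [|j] lti ltj /=.
- by rewrite eirr; case: ifP; lia.
- by rewrite ek //; case: ifP; case: ifP; lia.
- by rewrite esym ek //; case: ifP; case: ifP; lia.
- by rewrite indw //; case: ifP; case: ifP; lia.
Qed.

(** A shortest path among those staying in [a] before [y] is induced, since a chord would shorten
    it. *)
Lemma shortest_induced_path (a : pred T) x p y :
    path e x (rcons p y) -> all a (x :: p) -> ~~ a y ->
  exists2 p', induced_path (x :: rcons p' y) & all a (x :: p').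
Proof.
move=> pth inner nay.
pose good n := [exists q : n.-tuple T, path e x (rcons q y) && all a (x :: q)].
have exg : exists n, good n.
  exists (size p); apply/existsP; exists (in_tuple p); exact/andP.
case: (ex_minnP exg) => n /existsP[[q /= /eqP sq] /andP[qpath qin]] nmin.
have {}nmin q' : path e x (rcons q' y) -> all a (x :: q') -> size q <= size q'.
  move=> q'p q'in; rewrite sq; apply: nmin; apply/existsP.
  by exists (in_tuple q'); apply/andP.
exists q => //.
pose w := rcons q y; rewrite -/w; set n1 := (size w).
have sw : size w = (size q).+1 by rewrite /w size_rcons.
have step i : i < size w -> e (nth x (x :: w) i) (nth x w i).
  by move=> lti; exact: (pathP x qpath).
(* replacing the stretch from position [i] to position [j] by one edge *)
have shortcut i j : i <= j -> j < size w ->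
    e (nth x (x :: w) i) (nth x w j) -> i = j.
  move=> leij ltj eij; apply/eqP; rewrite eqn_leq leij /=.
  have ltjq : j < size q \/ j = size q by lia.
  pose q' := take i q ++ drop j q.
  have rq' : rcons q' y = take i w ++ drop j w.
    rewrite /q' /w rcons_cat -drop_rcons; last by lia.
    by rewrite -cats1 takel_cat //; lia.
  have : size q <= size q'.
    apply: nmin; last first.
      move: qin; rewrite /= all_cat => /andP[-> qin] /=.
      apply/andP; split; apply/allP => z.
        by move/mem_take; apply: (allP qin).
      by move/mem_drop; apply: (allP qin).
    rewrite rq' cat_path.
    have [pt pd] : path e x (take i w) /\ path e (last x (take j w)) (drop j w).
      split; first exact: take_path.
      by move: qpath; rewrite -/w -{1}(cat_take_drop j w) cat_path => /andP[].
    rewrite pt /= (drop_nth x) //=.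
    move: pd; rewrite (drop_nth x) //= => /andP[_ ->]; rewrite andbT.
    have -> // : last x (take i w) = nth x (x :: w) i.
    rewrite (last_nth x) size_take_min; have -> : minn i (size w) = i by lia.
    by case: (i) leij => //= i0 lei; rewrite nth_take.
  rewrite /q' size_cat size_take_min size_drop; lia.
(* A repetition before [y] would allow a shortcut to the successor of the second occurrence; [y]
   itself is not repeated because [a] fails there. *)
have nth_neq i j : i < j -> j < (size w).+1 -> nth x (x :: w) i <> nth x (x :: w) j.
  case: j => // j ltij ltj eqij.
  have [ltj1|] := boolP (j.+1 < size w).
    have := step _ ltj1; rewrite -eqij => /(shortcut i j.+1).
    by move=> H; have := H (ltnW ltij) ltj1; lia.
  move=> geji; have ej : j = size q by lia.
  have : a (nth x (x :: w) i).
    have : nth x (x :: w) i = nth x (x :: q) i.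
      by rewrite /w -rcons_cons nth_rcons /=; have -> : i < (size q).+1 by lia.
    by move=> ->; apply: (allP (s := x :: q) qin); rewrite mem_nth //=; lia.
  by rewrite eqij ej /= /w nth_rcons ltnn eqxx (negPf nay).
split.
  apply/(uniqP x) => i j; rewrite !inE /= => lti ltj eqij.
  have [lt|lt|//] := ltngtP i j; first by case: (nth_neq i j).
  by case: (nth_neq j i).
have adj i j : i < j -> j < (size w).+1 ->
    e (nth x (x :: w) i) (nth x (x :: w) j) = (j == i.+1).
  case: j => // j leij ltj; rewrite eqSS.
  apply/idP/eqP => [eij|eji].
    by apply/Logic.eq_sym/shortcut.
  by move: ltj; rewrite eji; apply: step.
move=> x0 i j lti ltj; rewrite !(set_nth_default x x0) //.
move: lti ltj => /= lti ltj; have [lt|lt|->] := ltngtP i j.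
- by rewrite adj //; lia.
- by rewrite esym adj //; lia.
- by rewrite eirr; lia.
Qed.

Lemma induced_path_drop n w : induced_path w -> induced_path (drop n w).
Proof.
move=> [uw indw]; split; first exact: drop_uniq.
move=> x0 i j; rewrite size_drop !nth_drop => lti ltj.
by rewrite indw; lia.
Qed.

Lemma induced_path_path x w : induced_path (x :: w) -> path e x w.
Proof.
move=> [_ indw]; apply/(pathP x) => i lti.
by rewrite (indw x i i.+1) ?eqxx //= ltnS ltnW.
Qed.

Definition chordal : Prop :=
  forall k (f : 'I_k -> T), induced_cycle e f -> k <= 3.

(** From the last neighbour of [k] in [w], the path up to [y] closes with [k] to an induced cycle.
    If that neighbour came before the end of [w], the length would be at least 4. *)
Lemma chordal_penultimate k w y :
    chordal -> induced_path (rcons w y) -> k \notin rcons w y -> w != [::] ->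
    e k (head k w) -> e k y -> e k (last k w).
Proof.
move=> ch indw kw wn0 ekh eky; apply/negPn/negP => nekl.
have sw : size (rcons w y) = (size w).+1 by rewrite size_rcons.
pose P i := (i < size w) && e k (nth k w i).
have exP : exists i, P i by exists 0; rewrite /P lt0n size_eq0 wn0 nth0.
have bP i : P i -> i <= size w by case/andP => /ltnW.
case: (ex_maxnP exP bP) => i /andP[lti eki] imax.
have neqi : i != (size w).-1 by apply: contraNneq nekl => Ei; rewrite -nth_last -Ei.
have [||||f /ch] := @induced_cycle_of_path k (drop i (rcons w y)).
- exact: induced_path_drop.
- by apply: contraNN kw => /mem_drop.
- by rewrite size_drop; lia.
- move=> j; rewrite size_drop nth_drop nth_rcons sw => ltj.
  have [ltij|] := ltnP (i + j) (size w).
    have -> : (j == ((size w).+1 - i).-1) = false by lia.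
    rewrite orbF; apply/idP/eqP => [ekj|->]; last by rewrite addn0.
    have := imax (i + j); rewrite /P ltij ekj => /(_ isT); lia.
  move=> geij; have -> : (i + j == size w) by lia.
  by rewrite eky; lia.
- by rewrite size_drop; lia.
Qed.

Fixpoint perfect_elimination (s : seq T) : Prop :=
  if s is v :: s' then
    [/\ v \notin s',
        {in s' &, forall x y, e v x -> e v y -> x != y -> e x y}
      & perfect_elimination s']
  else True.

(* Every component of the complement of [s] has a clique as neighbourhood. *)
Definition clique_attached (s : seq T) : Prop :=
  forall x u p y, x \in s -> y \in s -> x != y ->
    all [predC s] (u :: p) -> path e x (rcons (u :: p) y) -> e x y.

(* Maximum cardinality search: a vertex with the most neighbours in [s] sees the
   whole attachment clique of its component. *)
Lemma clique_attached_extend s v0 :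
    chordal -> clique_attached s -> v0 \notin s ->
  exists v, [/\ v \notin s, clique_attached (v :: s)
    & {in s &, forall x y, e v x -> e v y -> x != y -> e x y}].
Proof.
move=> ch att v0s.
case: (@arg_maxnP T v0 [predC s] (fun v => #|[set x in s | e v x]|) v0s) => v /= vs vmax.
have nbr_clique : {in s &, forall x y, e v x -> e v y -> x != y -> e x y}.
  move=> x y xs ys evx evy nxy; apply: (att x v [::] y) => //=.
    by rewrite vs.
  by rewrite esym evx evy.
(* Suppose [v] misses [y], and take an induced path from [v] to [y] that avoids [s] before [y]. Each
   neighbour of [v] in [s] sees [y], hence sees the last vertex before [y]. This vertex also sees
   [y], so it beats the maximum attained by [v]. *)
have core u p y : y \in s -> all [predC s] (u :: p) ->
    path e v (rcons (u :: p) y) -> e v y.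
  move=> ys avoid pth; apply/negPn/negP => nevy.
  have [||q indq qin] := @shortest_induced_path [predC s] v _ y pth.
  - by move: avoid; rewrite /= => /andP[-> ->]; rewrite vs.
  - by rewrite /= ys.
  have qpath := induced_path_path indq.
  have /eqP qn0 : q != [::].
    by apply: contraNneq nevy => q0; move: qpath; rewrite q0 /= andbT.
  have lastq : last v q \notin s by apply: (allP qin); exact: mem_last.
  have : [set x in s | e v x] \proper [set x in s | e (last v q) x].
    apply/properP; split; last first.
      exists y; rewrite !inE ys //=.
      by move: qpath; rewrite rcons_path => /andP[].
    apply/subsetP => k; rewrite !inE => /andP[ks evk]; rewrite ks /=.
    have nky : k != y by apply: contraNneq nevy => <-.
    rewrite esym; apply: (@chordal_penultimate k (v :: q) y ch indq) => //.
    - rewrite -/(rcons (v :: q) y) mem_rcons in_cons negb_or nky /=.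
      by apply/negP => /(allP qin) /=; rewrite ks.
    - by rewrite esym.
    - by apply: (att k v q y) => //=; rewrite esym evk.
  by move/proper_card; rewrite ltnNge (vmax _ lastq).
exists v; split=> // x u p y xs ys nxy avoid pth.
have avoids : all [predC s] (u :: p).
  by apply: sub_all avoid => z /=; rewrite inE negb_or => /andP[].
move: xs ys; rewrite !inE => /predU1P[Ex|xs] /predU1P[Ey|ys].
- by rewrite Ex Ey eqxx in nxy.
- by rewrite Ex; apply: (core u p) => //; rewrite -Ex.
(* Here [y] is [v], so the path is reversed to start at [v]. *)
- rewrite Ey esym; have : path e v (rcons (rev (u :: p)) x).
    have := rev_path e x (rcons (u :: p) y).
    rewrite last_rcons belast_rcons rev_cons Ey => ->; rewrite -Ey.
    have -> // : path (fun z => e^~ z) x (rcons (u :: p) y) = path e x (rcons (u :: p) y).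
    by apply: eq_path => z1 z2; rewrite esym.
  have : all [predC s] (rev (u :: p)) by rewrite all_rev.
  case: (rev (u :: p)) (size_rev (u :: p)) => // u' p' _; exact: core.
- exact: (att x u p).
Qed.

(** The search puts vertices at the head, with [clique_attached] as invariant; a repetition-free
    list of length [#|T|] contains every vertex. *)
Lemma chordal_perfect_elimination :
  chordal -> exists s, perfect_elimination s /\ forall x, x \in s.
Proof.
move=> ch.
suff H n : n <= #|T| ->
    exists s, [/\ size s = n, perfect_elimination s & clique_attached s].
  have [s [ss ps _]] := H #|T| (leqnn _).
  exists s; split=> // x.
  have us : uniq s.
    by elim: (s) ps => //= v s' IH [-> _ /IH].
  have /eqP/setP/(_ x) : [set z in s] == setT.
    by rewrite eqEcard subsetT cardsT cardsE (card_uniqP us) ss leqnn.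
  by rewrite !inE.
elim: n => [_|n IH ltn]; first by exists [::].
have [s [ss ps att]] := IH (ltnW ltn).
have [v0 v0s] : exists v0, v0 \notin s.
  apply/existsP; rewrite -negb_forall; apply/negP => /forallP all_s.
  have := card_size s; rewrite ss leqNgt.
  suff -> : #|s| = #|T| by rewrite ltn.
  by apply: eq_card => x; rewrite all_s.
have [v [vs att' clq]] := clique_attached_extend ch att v0s.
by exists (v :: s); rewrite /= ss; split.
Qed.

End Chordal.

(** * Rooted forest of a perfect elimination ordering *)

Section Tree.
Variables (T : finType) (e : rel T).
Hypotheses (esym : symmetric e) (eirr : irreflexive e).

Definition ancestor (lo hi : T -> nat) : rel T :=
  fun x y => lo x <= lo y <= hi x.

(* The intervals [lo x, hi x] are nested as the subtrees of a rooted forest on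
   [s] in which the parent of [y] is its last neighbour among the vertices of
   smaller rank [d], and [h] is the depth. *)
Record elimination_forest (s : seq T) (lo hi d h : T -> nat) : Prop := {
  ef_lo_hi : {in s, forall x, lo x <= hi x};
  ef_rank_lt : {in s, forall x, d x < size s};
  ef_rank_inj : {in s &, forall x y, d x = d y -> x = y};
  ef_clique : {in s & &, forall y x z, e x y -> e z y ->
    d x < d y -> d z < d y -> x != z -> e x z};
  ef_edge : {in s &, forall x y, e x y -> d x < d y -> ancestor lo hi x y};
  ef_parent : {in s &, forall x y, ancestor lo hi x y -> x != y ->
    d x < d y /\ exists p, [/\ p \in s, e p y, d p < d y, h y = (h p).+1
      & ancestor lo hi x p /\
        {in s, forall w, e w y -> d w < d y -> w = p \/ e w p /\ d w < d p}]} }.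

(** The head [v] enters last, as a leaf below its neighbour of largest rank, or as a new root if it
    has no neighbour in the tail. Its other neighbours see this parent, as they form a clique with
    it. *)
Lemma elimination_forest_exists s : perfect_elimination e s ->
  exists lo hi d h, elimination_forest s lo hi d h.
Proof.
elim: s => [_|v s IH [vs clq /IH[lo [hi [d [h F]]]]]].
  by exists (fun=> 0), (fun=> 0), (fun=> 0), (fun=> 0).
pose upd (f : T -> nat) (k : nat) x := if x == v then k else f x.
have updv f k : upd f k v = k by rewrite /upd eqxx.
have upds f k x : x \in s -> upd f k x = f x.
  by move=> xs; rewrite /upd; case: eqP xs vs => // -> ->.
(* [v] gets the one-point interval at [a]. Tripling makes room: an old interval [[lo, hi]] becomes
   [[3 lo, 3 hi + 2]], and [a] must avoid all old left ends so that [v] is a leaf. *)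
have extend (a hv : nat) :
    {in s, forall y, a <> 3 * lo y} ->
    {in s, forall x, e x v -> 3 * lo x <= a <= 3 * hi x + 2} ->
    {in s, forall x, 3 * lo x <= a <= 3 * hi x + 2 ->
      exists p, [/\ p \in s, e p v, hv = (h p).+1
      & ancestor lo hi x p /\ {in s, forall w, e w v -> w = p \/ e w p /\ d w < d p}]} ->
    elimination_forest (v :: s) (upd (fun x => 3 * lo x) a)
      (upd (fun x => 3 * hi x + 2) a) (upd d (size s)) (upd h hv).
  move=> a_neq a_edge a_parent; split.
  - move=> x; rewrite inE => /predU1P[->|xs]; rewrite ?updv ?upds //.
    by have := ef_lo_hi F xs; lia.
  - move=> x; rewrite inE => /predU1P[->|xs]; rewrite ?updv ?upds //=.
    by have := ef_rank_lt F xs; lia.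
  - move=> x y; rewrite !inE => /predU1P[->|xs] /predU1P[->|ys];
      rewrite ?updv ?upds //.
    + by have := ef_rank_lt F ys; lia.
    + by have := ef_rank_lt F xs; lia.
    + exact: (ef_rank_inj F).
  - move=> y x z; rewrite !inE => /predU1P[->|ys] /predU1P[->|xs] /predU1P[->|zs];
      rewrite ?updv ?upds ?eirr ?ltnn //.
    + by move=> exv ezv _ _; apply: clq; rewrite // esym.
    + by have := ef_rank_lt F ys; lia.
    + by have := ef_rank_lt F ys; lia.
    + by have := ef_rank_lt F ys; lia.
    + exact: (ef_clique F).
  - move=> x y; rewrite !inE /ancestor => /predU1P[->|xs] /predU1P[->|ys];
      rewrite ?updv ?upds ?eirr //.
    + by have := ef_rank_lt F ys; lia.
    + by move=> exv _; exact: a_edge.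
    + by move=> exy dxy; have := ef_edge F xs ys exy dxy; rewrite /ancestor; lia.
  - move=> x y; rewrite !inE /ancestor => /predU1P[->|xs] /predU1P[->|ys];
      rewrite ?updv ?upds ?eqxx //.
    + by have := a_neq _ ys; lia.
    + move=> /(a_parent _ xs)[p [ps epv hp [anc_xp last_p]]] _.
      split; first exact: (ef_rank_lt F).
      exists p; split; rewrite ?upds // ?inE ?ps ?orbT //; first exact: (ef_rank_lt F).
      split; first by move: anc_xp; rewrite /ancestor; lia.
      move=> w; rewrite inE => /predU1P[->|ws]; first by rewrite eirr.
      by move=> ewv _; rewrite upds //; exact: last_p.
    + move=> anc_xy nxy; have [|//|dxy [p [ps epy dpy hp [anc_xp last_p]]]] := ef_parent F xs ys.
        by rewrite /ancestor; lia.
      split=> //; exists p; split; rewrite ?upds // ?inE ?ps ?orbT //.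
      split; first by move: anc_xp; rewrite /ancestor; lia.
      move=> w; rewrite inE => /predU1P[->|ws]; last first.
        by rewrite !upds //; exact: last_p.
      by rewrite updv; have := ef_rank_lt F ys; lia.
have [/existsP[p0 Pp0]|/existsPn none] := boolP [exists p, (p \in s) && e p v].
  case: (@arg_maxnP T p0 (fun p => (p \in s) && e p v) d Pp0) => p /= /andP[ps epv] pmax.
  have last_p : {in s, forall w, e w v -> w = p \/ e w p /\ d w < d p}.
    move=> w ws ewv; have [->|nwp] := eqVneq w p; [by left|right].
    split; first by apply: clq; rewrite // esym.
    have := pmax w; rewrite ws ewv leq_eqVlt => /(_ isT)/orP[/eqP|//].
    by move=> /(ef_rank_inj F ws ps) Ew; rewrite Ew eqxx in nwp.
  (* The point [3 lo p + 1] is no multiple of 3, and it lies in the new interval of [x] exactly when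
     [lo p] lies in the old one, so it lies below [p] and the ancestors of [p] only. *)
  exists (upd (fun x => 3 * lo x) (3 * lo p).+1),
    (upd (fun x => 3 * hi x + 2) (3 * lo p).+1), (upd d (size s)), (upd h (h p).+1).
  apply: extend => [y _|x xs exv|x xs le_xp]; first lia.
    suff : ancestor lo hi x p by rewrite /ancestor; lia.
    have [->|[exp dxp]] := last_p x xs exv; last exact: (ef_edge F).
    by rewrite /ancestor leqnn (ef_lo_hi F).
  exists p; split=> //; split=> //.
  by move: le_xp; rewrite /ancestor; lia.
(* For a new root, the point is taken to the right of all tripled intervals. *)
pose M := \max_(x in s) hi x.
have leM x : x \in s -> hi x <= M.
  by move=> xs; exact: (@leq_bigmax_cond _ (mem s) hi).
exists (upd (fun x => 3 * lo x) (3 * M + 3)),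
  (upd (fun x => 3 * hi x + 2) (3 * M + 3)), (upd d (size s)), (upd h 0).
apply: extend => [y ys|x xs exv|x xs le_xM].
- by have := leM _ ys; have := ef_lo_hi F ys; lia.
- by have := none x; rewrite xs exv.
- by have := leM _ xs; lia.
Qed.

(** * Box representations read off the forest *)

Section Representations.
Variables (lo hi d h : T -> nat) (s : seq T).
Hypotheses (F : elimination_forest s lo hi d h) (all_s : forall x, x \in s).

Lemma forest_interval_adj x y : e x y -> lo x <= hi y.
Proof.
move=> exy; have lh z := ef_lo_hi F (all_s z).
have [lt|lt|/(ef_rank_inj F (all_s x) (all_s y)) Exy] := ltngtP (d x) (d y).
- have := ef_edge F (all_s x) (all_s y) exy lt.
  by rewrite /ancestor; have := lh y; lia.
- by rewrite esym in exy; have := ef_edge F (all_s y) (all_s x) exy lt; rewrite /ancestor; lia.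
- by rewrite Exy eirr in exy.
Qed.

Lemma forest_interval_sep x y :
  ~~ ancestor lo hi x y -> ~~ ancestor lo hi y x -> (hi y < lo x) || (hi x < lo y).
Proof. by rewrite /ancestor; lia. Qed.

(** Induction up the forest. If [z] came no later than [x], it would be a neighbour of the parent
    [p] of [y], with smaller rank. Either [x] is not adjacent to [p] and induction applies to [p],
    or [x] and [z] are adjacent as earlier neighbours of [p], so that their colours differ. *)
Lemma ancestor_colour (K : eqType) (c : T -> K) x y z :
    (forall x y, e x y -> c x != c y) ->
    ancestor lo hi x y -> x != y -> ~~ e x y -> e z y -> c z = c x -> d x < d z.
Proof.
move=> c_proper; have [n] := ubnP (d y); elim: n y z => // n IH y z ltn.
move=> anc_xy nxy nexy ezy czx; rewrite ltnNge; apply/negP => dzx.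
have [dxy [p [_ epy dpy _ [anc_xp last_p]]]] := ef_parent F (all_s x) (all_s y) anc_xy nxy.
have nxp : x != p by apply: contraNneq nexy => ->.
have [dxp _] := ef_parent F (all_s x) (all_s p) anc_xp nxp.
have [Ezp|[ezp dzp]] := last_p z (all_s z) ezy (leq_ltn_trans dzx dxy).
  by move: dzx; rewrite Ezp leqNgt dxp.
have [exp|nexp] := boolP (e x p); last first.
    have dpn : d p < n by lia.
    by have := IH p z dpn anc_xp nxp nexp ezp czx; rewrite ltnNge dzx.
have nxz : x != z by apply: contraNneq nexy => ->.
have := ef_clique F (all_s p) (all_s x) (all_s z) exp ezp dxp dzp nxz.
by move/c_proper; rewrite czx eqxx.
Qed.

Lemma box_representable_forest_colour (D : nat) (c : T -> 'I_D) :
  (forall x y, e x y -> c x != c y) -> box_representable e #|{: option 'I_D}|.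
Proof.
(* Ranks are reversed: the neighbours of [y] in the class of a non-adjacent ancestor [x] come after
   [x] in rank, while [colour_sep] wants them below. *)
move=> c_proper; pose rho x := size s - d x.
have dlt x := ef_rank_lt F (all_s x).
have rho_inj x y : x != y -> rho x <> rho y.
  move=> nxy Er; have /(ef_rank_inj F (all_s x) (all_s y)) : d x = d y.
    by move: Er (dlt x) (dlt y); rewrite /rho; lia.
  by apply/eqP.
have anc_sep x y : x != y -> ~~ e x y -> ancestor lo hi x y ->
    (colour_hi e c rho (c x) y < colour_lo c rho (c x) x)
    || (colour_hi e c rho (c x) x < colour_lo c rho (c x) y).
  move=> nxy nexy anc_xy; apply: colour_sep; first exact: rho_inj.
  move=> _ z; rewrite esym => ezy czx.
  have := ancestor_colour c_proper anc_xy nxy nexy ezy czx.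
  by move: (dlt x) (dlt z); rewrite /rho; lia.
apply: (@box_representable_nat _ _ e
  (fun i => if i is Some k then colour_lo c rho k else lo)
  (fun i => if i is Some k then colour_hi e c rho k else hi)) => //.
- by case=> [k|] x; [exact: colour_lo_hi|exact: (ef_lo_hi F (all_s x))].
- by case=> [k|] x y; [exact: colour_adj|exact: forest_interval_adj].
move=> x y nxy nexy.
have [anc_xy|nanc_xy] := boolP (ancestor lo hi x y).
  by exists (Some (c x)); exact: anc_sep.
have [anc_yx|nanc_yx] := boolP (ancestor lo hi y x).
  by exists (Some (c y)); rewrite orbC; apply: anc_sep; rewrite // 1?eq_sym 1?esym.
by exists None; exact: forest_interval_sep.
Qed.

(** Without triangles, an edge joins a vertex to its parent, so the depths differ by 1 and the
    intervals [[h, h + 1]] meet. For a non-adjacent ancestor the depths differ by at least 2. *)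
Lemma box_representable_forest_depth :
  (forall x y z, e x y -> e y z -> e z x -> False) -> box_representable e #|{: bool}|.
Proof.
move=> no_triangle.
have anc_h x y : ancestor lo hi x y -> x != y -> h x < h y.
  have [n] := ubnP (d y); elim: n y => // n IH y ltn anc_xy nxy.
  have [dxy [p [_ epy dpy -> [anc_xp _]]]] := ef_parent F (all_s x) (all_s y) anc_xy nxy.
  have [->|nxp] := eqVneq x p; first exact: leqnn.
  by apply: ltnW; apply: IH => //; lia.
have anc_sep x y : x != y -> ~~ e x y -> ancestor lo hi x y -> (h x).+1 < h y.
  move=> nxy nexy anc_xy.
  have [dxy [p [_ epy dpy -> [anc_xp _]]]] := ef_parent F (all_s x) (all_s y) anc_xy nxy.
  have nxp : x != p by apply: contraNneq nexy => ->.
  by rewrite ltnS; exact: anc_h.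
have edge_h x y : e x y -> d x < d y -> h y = (h x).+1.
  move=> exy dxy; have anc_xy := ef_edge F (all_s x) (all_s y) exy dxy.
  have nxy : x != y by apply: contraTneq exy => ->; rewrite eirr.
  have [_ [p [_ epy dpy -> [_ last_p]]]] := ef_parent F (all_s x) (all_s y) anc_xy nxy.
  have [->//|[exp _]] := last_p x (all_s x) exy dxy.
  by case: (no_triangle x p y) => //; rewrite esym.
apply: (@box_representable_nat _ _ e
  (fun b => if b then lo else h) (fun b => if b then hi else S \o h)) => //.
- by case=> x /=; [exact: (ef_lo_hi F (all_s x))|exact: leqnSn].
- case=> x y /= exy; first exact: forest_interval_adj.
  have [lt|lt|/(ef_rank_inj F (all_s x) (all_s y)) Exy] := ltngtP (d x) (d y).
  + by rewrite (edge_h x y); lia.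
  + by rewrite (edge_h y x) // esym.
  + by rewrite Exy leqnSn.
move=> x y nxy nexy.
have [anc_xy|nanc_xy] := boolP (ancestor lo hi x y).
  by exists false; rewrite /= orbC anc_sep // 1?eq_sym 1?esym.
have [anc_yx|nanc_yx] := boolP (ancestor lo hi y x).
  by exists false; rewrite /= anc_sep // 1?eq_sym 1?esym.
by exists true; exact: forest_interval_sep.
Qed.
End Representations.

Lemma chordal_elimination_forest : chordal e ->
  exists s lo hi d h, elimination_forest s lo hi d h /\ forall x, x \in s.
Proof.
move=> /(chordal_perfect_elimination esym eirr)[s [/elimination_forest_exists]].
by move=> [lo [hi [d [h F]]]] all_s; exists s, lo, hi, d, h.
Qed.

Lemma chordal_box_representable :
  chordal e -> box_representable e (max_degree e).+2.
Proof.
move=> /chordal_elimination_forest[s [lo [hi [d [h [F all_s]]]]]].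
have [c c_proper] := greedy_colouring esym eirr (leq_max_degree e).
by have := box_representable_forest_colour F all_s c_proper; rewrite card_option card_ord.
Qed.

Lemma acyclic_box_representable :
  (forall k (f : 'I_k -> T), ~ induced_cycle e f) -> box_representable e 2.
Proof.
move=> acyclic.
have /chordal_elimination_forest[s [lo [hi [d [h [F all_s]]]]]] : chordal e.
  by move=> k f /acyclic.
rewrite -card_bool; apply: (box_representable_forest_depth F all_s) => x y z exy eyz ezx.
have neq u v : e u v -> u != v by apply: contraTneq => ->; rewrite eirr.
(* A triangle is an induced cycle of length 3, obtained by closing the path [y], [z] with [x]. *)
have [||||f /acyclic //] := @induced_cycle_of_path T e esym eirr x [:: y; z].
- split; first by rewrite /= inE neq.
  by move=> x0 [|[|i]] [|[|j]] //= _ _; rewrite ?eirr // esym.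
- by rewrite !inE negb_or neq // eq_sym neq.
- by [].
- by move=> [|[|i]] //= _; rewrite esym.
Qed.

End Tree.

(** * Comparison of the dimensions with [b] *)

Theorem theorem14 (T : finType) (e : rel T) (b : nat) :
  symmetric e -> irreflexive e ->
  boxicity e b -> (3 <= b)%N ->
  exists (k : nat) (f : 'I_k -> T),
    induced_cycle e f /\ (trunc_log (max_degree e) (b - 2) + 2 <= k)%N.
Proof.
move=> esym eirr [_ minb] b3; apply: NNPP => no_cycle.
set D := max_degree e in no_cycle *; set t := trunc_log D _ in no_cycle *.
have short k (f : 'I_k -> T) : induced_cycle e f -> k < t + 2.
  by move=> indf; rewrite ltnNge; apply/negP => lek; apply: no_cycle; exists k, f.
have [t_le1|t_gt1] := leqP t 1.
  (* Every induced cycle is shorter than [t + 2 <= 3], so there is none. *)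
  apply: (minb 2) => //; apply: acyclic_box_representable => // k f indf.
  by have := short _ _ indf; case: indf; lia.
(* [trunc_log] is 0 for bases at most 1, so a positive [t] forces [D > 1]. *)
have D_gt1 : 1 < D.
  by have := ltnW t_gt1; rewrite /t trunc_log_gt0 => /andP[].
have Dt : D ^ t <= b - 2 by apply: trunc_logP => //; lia.
have [t_gt2|t_le2] := ltnP 2 t.
  apply: minb (box_representable_square esym eirr).
  have D3 : D ^ 3 <= D ^ t by rewrite leq_exp2l.
  rewrite -/D.
  by move: (leq_trans D3 Dt); rewrite !expnS expn0; nia.
have Et : t = 2 by lia.
apply: minb (chordal_box_representable esym eirr _).
  by rewrite -/D; move: Dt; rewrite Et !expnS expn0; nia.
by move=> k f /short; lia.
Qed.
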